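(* Fix an integer $b\geq 2$. For each positive integer $k$, the numbers $0,1,\dots,bk-1$ can be arranged (each used exactly once) in a $b\times k$ matrix $A_k=[a_{i,j}]_{1\le i\le b,\,1\le j\le k}$ such that: (i) $a_{1,j}=j-1$ for $j=1,\dots,k$; (ii) $a_{1,j}\prec_b a_{i,j}$ for $i=1,\dots,b$ and $j=1,\dots,k$; and (iii) $a_{i,j}-a_{1,j}$ is the sum of exactly $i-1$ powers of $b$; that is, $s_b(a_{i,j})=s_b(a_{1,j})+i-1$, for $i=1,\dots,b$ and $j=1,\dots,k$.
   Context: For $n\in\mathbb{Z}_{\ge0}$ write $n=\sum_{i\ge0}\alpha_i(n;b)b^i$ with digits $\alpha_i(n;b)\in\{0,\dots,b-1\}$, and let $s_b(n)=\sum_i\alpha_i(n;b)$. The partial order $\prec_b$ is defined by $n\prec_b m$ iff $\alpha_i(n;b)\leq\alpha_i(m;b)$ for every $i$. A ''power of $b$'' means $b^r$ with $r\in\mathbb{Z}_{\ge0}$ (repetitions allowed in the sum). *)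

(* Defs.v *)
From mathcomp Require Import all_boot all_order all_algebra.

Set Implicit Arguments.
Unset Strict Implicit.
Unset Printing Implicit Defensive.

Definition digit (b n i : nat) : nat := (n %/ b ^ i) %% b.

(* The range i < n covers every nonzero digit: for b >= 2, i < b ^ i, so
   n <= i forces n %/ b ^ i = 0. *)
Definition digit_sum (b n : nat) : nat := \sum_(i < n) digit b n i.

Definition digit_le (b n m : nat) : Prop :=
  forall i : nat, digit b n i <= digit b m i.

(* r lists the exponents, so the same power may be used several times. *)
Definition sum_of_powers (b c n : nat) : Prop :=
  exists2 r : seq nat, size r = c & n = \sum_(e <- r) b ^ e.

Definition first_row (b : nat) (hb : 2 <= b) : 'I_b := Ordinal (ltnW hb).

(* Main.v *)
Require Import Defs.
From mathcomp Require Import all_boot all_order all_algebra.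
From mathcomp Require Import zify.

(* More generally, for every N the numbers below N can be arranged in columns
   of height b, the last one possibly incomplete, with the required relations
   in each column.  Reading the columns one after the other, this is a
   permutation f of [0, N) such that f p dominates p %/ b digitwise, with total
   excess p %% b.  By induction there is such an arrangement of the m with
   b * m + e < N, for each last digit e; only two sizes occur.  The columns q of
   these b arrangements, with the last digits e appended, consist of the
   entries needed for the columns b * q + c.  When these are complete, the
   column b * q + c takes the entries with e = c.  Otherwise the entries are
   distributed separately for each digit sum: the available e form an interval,
   so do the c of the columns where that digit sum is needed, and the increasing
   bijection between the two intervals satisfies c <= e, as domination
   requires. *)

(** Built by appending last digits, as the arrangement is, so that domination, digit sums and powers
    all follow by the same induction. *)
Inductive digit_excess (b : nat) : nat -> nat -> nat -> Prop :=
| digit_excess0 : digit_excess b 0 0 0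
| digit_excess_step n m i c e : c <= e -> e < b -> digit_excess b n m i ->
    digit_excess b (b * n + c) (b * m + e) (i + (e - c)).

Lemma divn_mulDl b n c : c < b -> (b * n + c) %/ b = n.
Proof. by move=> cb; rewrite mulnC divnMDl ?divn_small ?addn0 //; lia. Qed.

Lemma modn_mulDl b n c : c < b -> (b * n + c) %% b = c.
Proof. by move=> cb; rewrite mulnC modnMDl modn_small. Qed.

Lemma digit0_mulDl b n c : c < b -> digit b (b * n + c) 0 = c.
Proof. by move=> cb; rewrite /digit expn0 divn1 modn_mulDl. Qed.

Lemma digitS_mulDl b n c i : c < b -> digit b (b * n + c) i.+1 = digit b n i.
Proof. by move=> cb; rewrite /digit expnS divnMA divn_mulDl. Qed.

Lemma digit_eq0 b n i : 2 <= b -> n <= i -> digit b n i = 0.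
Proof.
move=> hb ni; rewrite /digit divn_small ?mod0n //.
exact: leq_ltn_trans ni (ltn_expl _ hb).
Qed.

(** The range in [digit_sum] varies with [n]; a common range is needed to compare numbers. *)
Lemma digit_sum_bound b n B : 2 <= b -> n <= B ->
  digit_sum b n = \sum_(i < B) digit b n i.
Proof.
move=> hb nB; rewrite /digit_sum -!(big_mkord xpredT (digit b n)).
rewrite [RHS](big_cat_nat (leq0n n) nB) //= -[LHS]addn0; congr addn.
by rewrite big_nat big1 // => i /andP[ni _]; apply: digit_eq0.
Qed.

Lemma digit_sum_mulDl b n c : 2 <= b -> c < b ->
  digit_sum b (b * n + c) = digit_sum b n + c.
Proof.
move=> hb cb; rewrite (@digit_sum_bound b _ (b * n + c).+1) //.
rewrite big_ord_recl digit0_mulDl // addnC; congr (_ + _).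
rewrite (@digit_sum_bound b n (b * n + c)) //; last nia.
by apply: eq_bigr => i _; rewrite digitS_mulDl.
Qed.

Lemma digit_excess_le_digit b n m i : digit_excess b n m i -> digit_le b n m.
Proof.
elim=> {n m i} [//|n m i c e ce eb _ IH] [|j].
  by rewrite !digit0_mulDl //; lia.
by rewrite !digitS_mulDl //; lia.
Qed.

Lemma digit_excess_sum b n m i : 2 <= b ->
  digit_excess b n m i -> digit_sum b m = digit_sum b n + i.
Proof.
move=> hb; elim=> {n m i} [|n m i c e ce eb _ IH]; first by rewrite addn0.
by rewrite !digit_sum_mulDl //; lia.
Qed.

Lemma digit_excess_leq b n m i : digit_excess b n m i -> n <= m.
Proof. by elim=> {n m i} [//|n m i c e ce _ _ IH]; nia. Qed.

Lemma digit_excess_powers b n m i :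
  digit_excess b n m i -> sum_of_powers b i (m - n).
Proof.
elim=> {n m i} [|n m i c e ce _ exc [r <- nm]].
  by exists [::]; rewrite ?big_nil.
(* Multiplying by [b] raises each exponent by one; the last digit contributes [e - c] copies of
   [b ^ 0]. *)
exists ([seq x.+1 | x <- r] ++ nseq (e - c) 0).
  by rewrite size_cat size_map size_nseq.
rewrite big_cat big_map big_nseq expn0 iter_addn_0 mul1n /=.
rewrite (eq_bigr (fun x => b * b ^ x)) => [|x _]; last by rewrite expnS.
rewrite -big_distrr /= -nm.
have := digit_excess_leq _ _ _ _ exc; nia.
Qed.

Lemma digit_excess0_eq b n m i : digit_excess b n m i -> i = 0 -> m = n.
Proof.
elim=> {n m i} [//|n m i c e ce _ _ IH] i0.
by rewrite IH; lia.
Qed.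

(* The columns b * q + c, for fixed q, have b * h + r entries in all, and t is
   the digit sum of an entry minus that of q.  The c that occur for t start at
   t - (b - 1), the available last digits at t - h or t - (h - 1); truncated
   subtraction is intended. *)
Definition block_digit (b h r c t : nat) : nat :=
  c + (t - (if t < h + r then h else h.-1) - (t - b.-1)).

(** Positions and entries obey the same bound with transposed roles: column [h] has only the rows
    [i < r], and row [h = c + i - e] only the last digits [e < r]. *)
Lemma block_digitP b h r c i : i < b -> (h < b /\ r < b) \/ (h = b /\ r = 0) ->
  b * c + i < b * h + r ->
  let e := block_digit b h r c (c + i) in
  [/\ c <= e, e < b, e <= c + i, c + i - e < b
    & b * (c + i - e) + e < b * h + r].
Proof.
move=> ib hr lt_ci e.
have ch : c < h \/ (c = h /\ i < r).
  case: (ltnP c h) => ch; [by left|right].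
  have : c = h by nia.
  by move=> E; split=> //; nia.
have [ce eb et it ih] : [/\ c <= e, e < b, e <= c + i, c + i - e < b
    & c + i - e < h \/ (c + i - e = h /\ e < r)].
  by rewrite /e /block_digit; case: ifP => ?; split; lia.
by split=> //; nia.
Qed.

Definition column_arrangement (b N : nat) (f : nat -> nat) : Prop :=
  [/\ forall p, p < N -> f p < N,
      {in gtn N &, injective f}
    & forall p, p < N -> digit_excess b (p %/ b) (f p) (p %% b)].

Lemma column_arrangement_small b N : 2 <= b -> N <= b ->
  column_arrangement b N id.
Proof.
move=> hb Nb; split=> // p pN.
rewrite divn_small ?modn_small; try lia.
have := @digit_excess_step b 0 0 0 0 p (leq0n p) _ (digit_excess0 b).
by rewrite !muln0 !add0n subn0; apply; lia.
Qed.

Section Step.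

Variables (b N : nat) (f g : nat -> nat).
Hypothesis hb : 2 <= b.
Hypothesis fP : column_arrangement b (N %/ b) f.
Hypothesis gP : column_arrangement b (N %/ b).+1 g.

Let height q := if q < N %/ b %/ b then b else N %/ b %% b.
Let extra q := if q < N %/ b %/ b then 0 else N %% b.
Let last_digit p :=
  block_digit b (height (p %/ b %/ b)) (extra (p %/ b %/ b))
    (p %/ b %% b) (p %/ b %% b + p %% b).
(** Same [q]; the row is what remains of the digit sum after the last digit. *)
Let source p := b * (p %/ b %/ b) + (p %/ b %% b + p %% b - last_digit p).
Let pick e := if e < N %% b then g else f.

Let stepP p : p < N ->
  [/\ p %/ b %% b <= last_digit p, last_digit p < b,
      last_digit p <= p %/ b %% b + p %% b,
      p %/ b %% b + p %% b - last_digit p < b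
    & b * source p + last_digit p < N].
Proof.
move=> pN; rewrite /source /last_digit.
set q := p %/ b %/ b; set c := p %/ b %% b; set i := p %% b.
have b0 : 0 < b by lia.
have Ep : p = b * (b * q + c) + i.
  by rewrite [LHS](divn_eq p b) [p %/ b in LHS](divn_eq _ b) -/q -/c -/i; lia.
set K := N %/ b; set Q := K %/ b.
have EN : N = b * (b * Q + K %% b) + N %% b.
  by rewrite [LHS](divn_eq N b) -/K [K in LHS](divn_eq _ b) -/Q; lia.
have Kb : K %% b < b by rewrite ltn_mod.
have Nb : N %% b < b by rewrite ltn_mod.
have ib : i < b by rewrite ltn_mod.
have cb : c < b by rewrite ltn_mod.
have hr : (height q < b /\ extra q < b) \/ (height q = b /\ extra q = 0).
  by rewrite /height /extra -/K -/Q; case: ifP; [right | left].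
have qQ : q <= Q by apply: leq_div2r; apply: leq_div2r; exact: ltnW.
(* Block [q] starts at [b * (b * q)], so bounds inside it turn into bounds by [N]. *)
have lt_block m : m < b * height q + extra q -> b * (b * q) + m < N.
  rewrite /height /extra -/K -/Q; case: ifP => qQ' mlt; rewrite EN; last first.
    have -> : q = Q by lia.
    by rewrite [b * (_ + _)]mulnDr -addnA ltn_add2l.
  have : b * (b * q.+1) <= b * (b * Q) by rewrite !leq_mul2l qQ' !orbT.
  by rewrite !mulnS; lia.
have lt_ci : b * c + i < b * height q + extra q.
  rewrite /height /extra -/K -/Q; case: ifP => qQ'.
    by have := leq_mul (leqnn b) cb; lia.
  have EqQ : q = Q by lia.
  by move: pN; rewrite {1}Ep {1}EN EqQ !mulnDr -!addnA ltn_add2l.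
have [ce eb et it lt_e] := block_digitP b _ _ c i ib hr lt_ci.
split=> //; have := lt_block _ lt_e; lia.
Qed.

Let pickP e : column_arrangement b (N %/ b + (e < N %% b)) (pick e).
Proof. by rewrite /pick; case: ifP; rewrite ?addn1 ?addn0. Qed.

Let lt_class m e : e < b -> (b * m + e < N) = (m < N %/ b + (e < N %% b)).
Proof.
move=> eb; have Nb : N %% b < b by rewrite ltn_mod; lia.
rewrite {1}(divn_eq N b); case: ltnP => eN /=; apply/idP/idP; nia.
Qed.

Lemma column_arrangement_step :
  column_arrangement b N
    (fun p => b * pick (last_digit p) (source p) + last_digit p).
Proof.
split=> [p pN | p1 p2 p1N p2N E | p pN].
- have [_ eb _ _ srcN] := stepP p pN.
  have [bnd _ _] := pickP (last_digit p).
  by rewrite lt_class // bnd // -lt_class.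
- have [_ eb1 et1 it1 src1] := stepP p1 p1N.
  have [_ eb2 et2 it2 src2] := stepP p2 p2N.
  have Ee : last_digit p1 = last_digit p2.
    by have := congr1 (modn^~ b) E; rewrite /= !modn_mulDl.
  have [_ inj _] := pickP (last_digit p1).
  have Es : source p1 = source p2.
    apply: inj; rewrite ?inE -?lt_class //; first by rewrite Ee.
    by have := congr1 (divn^~ b) E; rewrite /= !divn_mulDl // -Ee.
  have Eq : p1 %/ b %/ b = p2 %/ b %/ b.
    by have := congr1 (divn^~ b) Es; rewrite !divn_mulDl.
  have Et : p1 %/ b %% b + p1 %% b = p2 %/ b %% b + p2 %% b.
    by move: Es; rewrite /source Eq Ee; lia.
  (* For fixed [q] and digit sum, [block_digit] is [c] plus a constant. *)
  have Ec : p1 %/ b %% b = p2 %/ b %% b.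
    by move: Ee; rewrite /last_digit /block_digit Eq Et; apply: addIn.
  rewrite (divn_eq p1 b) (divn_eq (p1 %/ b) b) Eq Ec.
  have -> : p1 %% b = p2 %% b by lia.
  by rewrite -(divn_eq (p2 %/ b) b) -divn_eq.
- have [ce eb et it srcN] := stepP p pN.
  have [_ _ exc] := pickP (last_digit p).
  have {exc} : digit_excess b (p %/ b %/ b) (pick (last_digit p) (source p))
     (p %/ b %% b + p %% b - last_digit p).
    have := exc (source p); rewrite -lt_class // => /(_ srcN).
    by rewrite divn_mulDl // modn_mulDl.
  (* With [c] and [e] appended, the excess is [(c + i - e) + (e - c) = i]. *)
  move/(digit_excess_step _ _ _ _ _ _ ce eb).
  by rewrite mulnC -divn_eq; congr digit_excess; lia.
Qed.

End Step.

Lemma column_arrangement_exists b N : 2 <= b ->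
  exists f, column_arrangement b N f.
Proof.
move=> hb; elim/ltn_ind: N => N IH.
case: (leqP N b) => Nb; first by exists id; exact: column_arrangement_small.
(* This would fail for [N = b = 2], which the single-column case covers. *)
have KN : (N %/ b).+1 < N.
  by have := divn_eq N b; case: (N %/ b) => [|[|K]]; nia.
have [f fP] := IH _ (ltnW KN); have [g gP] := IH _ KN.
by eexists; exact: (column_arrangement_step b N f g hb fP gP).
Qed.

(* Rows and columns are indexed from 0, so A i j stands for a_{i+1,j+1}. *)
Theorem theorem5 (b : nat) (hb : 2 <= b) (k : nat) (hk : 0 < k) :
  exists A : 'M[nat]_(b, k),
    [/\ perm_eq [seq A p.1 p.2 | p : 'I_b * 'I_k] (iota 0 (b * k)),
        (forall j : 'I_k, A (first_row hb) j = j),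
        (forall (i : 'I_b) (j : 'I_k), digit_le b (A (first_row hb) j) (A i j)) &
        (forall (i : 'I_b) (j : 'I_k),
            [/\ A (first_row hb) j <= A i j,
                sum_of_powers b i (A i j - A (first_row hb) j) &
                digit_sum b (A i j) = digit_sum b (A (first_row hb) j) + i])].
Proof.
have [f [f_lt f_inj f_exc]] := column_arrangement_exists b (b * k) hb.
pose A : 'M[nat]_(b, k) := (\matrix_(i, j) f (b * j + i)%N)%R.
have pos_lt (i : 'I_b) (j : 'I_k) : b * j + i < b * k.
  by have := ltn_ord i; have := ltn_ord j; nia.
have excA (i : 'I_b) (j : 'I_k) : digit_excess b j (A i j) i.
  by have := f_exc _ (pos_lt i j); rewrite mxE divn_mulDl ?modn_mulDl.
have A0 (j : 'I_k) : A (first_row hb) j = j.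
  exact: (digit_excess0_eq _ _ _ _ (excA (first_row hb) j) erefl).
exists A; split=> // [|i j|i j]; last first.
- rewrite A0; split; [exact: digit_excess_leq _ _ _ _ (excA i j) | |].
  + exact: digit_excess_powers _ _ _ _ (excA i j).
  + exact: digit_excess_sum _ _ _ _ hb (excA i j).
- by rewrite A0; exact: digit_excess_le_digit _ _ _ _ (excA i j).
set s := image _ _.
have s_uniq : uniq s.
  rewrite map_inj_uniq ?enum_uniq // => -[i1 j1] [i2 j2] /=; rewrite !mxE => E.
  have := f_inj _ _ (pos_lt i1 j1) (pos_lt i2 j2) E => Ep.
  congr pair; apply: val_inj => /=.
    by rewrite -[LHS](modn_mulDl b j1 i1) // Ep modn_mulDl.
  by rewrite -[LHS](divn_mulDl b j1 i1) // Ep divn_mulDl.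
have s_sub : {subset s <= iota 0 (b * k)}.
  move=> m /mapP[[i j] _ ->] /=.
  by rewrite mem_iota mxE add0n f_lt.
(* Being [b * k] distinct numbers below [b * k], the entries exhaust them. *)
have s_size : size (iota 0 (b * k)) <= size s.
  by rewrite size_iota size_map -cardE card_prod !card_ord.
have [_ s_mem] := uniq_min_size s_uniq s_sub s_size.
by apply: uniq_perm; rewrite ?iota_uniq.
Qed.
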